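(* Let $t>1$ be odd, $G=\langle x,u,v\rangle\cong\mathbb{Z}_t\times\mathbb{Z}_2^2$, and let $\mathcal{S}$ be the set of cocycles $\psi:G\times G\to\{\pm1\}$ of the form $\psi=\partial_{d_1}\cdots\partial_{d_k}\,\rho$. For every $\psi\in\mathcal{S}$: 1. The shift actions by $x$, $u$ and $v$ on $\psi$ are the diagrammatic actions $T_1$, $s_{12}s_{34}$ and $s_{13}s_{24}$, respectively; that is, $\psi\cdot x=T_1(\psi)$, $\psi\cdot u=s_{12}s_{34}(\psi)$, and $\psi\cdot v=s_{13}s_{24}(\psi)$. 2. The automorphism actions by $h_r$ ($r\in\mathbb{Z}_t^*$), $h_{23}$ and $h_{243}$ on $\psi$ are the diagrammatic actions $V_{r^{-1}}$, $C_2s_{23}$ and $s_{234}:=s_{23}s_{24}$, respectively; that is, $\psi\circ(h_r\times h_r)=V_{r^{-1}}(\psi)$, $\psi\circ(h_{23}\times h_{23})=C_2s_{23}(\psi)$, and $\psi\circ(h_{243}\times h_{243})=s_{234}(\psi)$.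
   Context: Let $t>1$ be odd and $G=\langle x,u,v: x^t=u^2=v^2=1,\ xu=ux,\ xv=vx,\ uv=vu\rangle\cong\mathbb{Z}_t\times\mathbb{Z}_2^2$. List the elements of $G$ as $g_1,\dots,g_{4t}$ with $g_{4j+1}=x^j$, $g_{4j+2}=x^ju$, $g_{4j+3}=x^jv$, $g_{4j+4}=x^juv$ for $0\le j\le t-1$. $\mathbb{Z}_t^*$ is the group of units of $\mathbb{Z}_t$, and $[m]_n$ denotes $m \bmod n$. A (normalized) cocycle is a map $\psi:G\times G\to\{\pm1\}$ with $\psi(g,1)=\psi(1,g)=1$ and $\psi(g,h)\psi(gh,k)=\psi(g,hk)\psi(h,k)$ for all $g,h,k\in G$. For $f:G\to\{\pm1\}$ put $\partial f(g,h)=f(g)^{-1}f(h)^{-1}f(gh)$. Let $\delta_i:G\to\{\pm1\}$ be $-1$ at $g_i$ and $1$ elsewhere. Put $\partial_i=\partial\delta_i$ for $2\le i\le 4t$, and let $\partial_1=-\partial\delta_1=\partial(-\delta_1)$ (the normalized version of $\partial\delta_1$). Let $\rho$ be the cocycle $\rho(x^ia,x^jb)=\rho_0(a,b)$ for $a,b\in\{1,u,v,uv\}$, where, with rows and columns ordered $1,u,v,uv$, $$[\rho_0(a,b)]=\begin{pmatrix}1&1&1&1\\1&-1&1&-1\\1&-1&-1&1\\1&1&-1&-1\end{pmatrix}.$$ For $D\subseteq\{1,\dots,4t\}$ write $\psi_D=\big(\prod_{d\in D}\partial_d\big)\rho$ and $\mathcal{S}=\{\psi_D: D\subseteq\{1,\dots,4t\}\}$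 (different $D$ may give the same cocycle). Diagrammatic operations. For $e\in\{1,2,3,4\}$ let $\mathbf{c}_e$ be the set of elements of $D$ congruent to $e$ modulo $4$, and write $D$ as $\{\mathbf{c}_2,\mathbf{c}_3,\mathbf{c}_4,\mathbf{c}_1\}$. $\mathbf{c}_e+k$ is obtained by adding $k$ to each element modulo $4t$ (residues in $\{1,\dots,4t\}$). Define: - complement: $C_2$ replaces $\mathbf{c}_2$ by its complement in $\{d\in\{1,\dots,4t\}: d\equiv2\bmod 4\}$ and leaves $\mathbf{c}_3,\mathbf{c}_4,\mathbf{c}_1$ unchanged; - swappings: for $1\le a<b\le4$, $s_{ab}$ exchanges classes $a$ and $b$, i.e. the new class-$a$ set is $\mathbf{c}_b-(b-a)$, the new class-$b$ set is $\mathbf{c}_a+(b-a)$, and the other two are unchanged; - rotations: $T_i$ ($0\le i\le t-1$) replaces each $\mathbf{c}_e$ by $\mathbf{c}_e-4i$; - dilatations: for $r\in\mathbb{Z}_t^*$, $V_r$ sends each $4j+e\in D$ ($0\le j\le t-1$, $1\le e\le4$) to $4[jr]_t+e$. Each operation $F$ is regarded as an operation on cocycles of $\mathcal{S}$ by $F(\psi_D)=\psi_{F(D)}$; on cocycles $C_2$ commutes with all swappings. The product $s_{234}=s_{23}s_{24}$ means: apply $s_{23}$ first, then $s_{24}$; i.e. $\{\mathbf{c}_2,\mathbf{c}_3,\mathbf{c}_4,\mathbf{c}_1\}\mapsto\{\mathbf{c}_4-2,\mathbf{c}_2+1,\mathbf{c}_3+1,\mathbf{c}_1\}$. Bundle actions.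 For $a\in G$ the shift of $\psi$ is $(\psi\cdot a)(g,h)=\psi(ag,h)\psi(a,h)^{-1}$. For $\theta\in\mathrm{Aut}(G)$ the automorphism action of $\theta$ is $\psi\mapsto\psi\circ(\theta\times\theta)$. The automorphisms are $h_r:x\mapsto x^r,u\mapsto u,v\mapsto v$ (for $r\in\mathbb{Z}_t^*$); $h_{23}:x\mapsto x,u\mapsto v,v\mapsto u$; $h_{243}:x\mapsto x,u\mapsto uv,v\mapsto u$. *)

(* Defs.v *)
From mathcomp Require Import all_boot all_order all_fingroup all_algebra.
From mathcomp Require Import ring.

Set Implicit Arguments.
Unset Strict Implicit.
Unset Printing Implicit Defensive.

Import GroupScope GRing.Theory Num.Theory.

Definition G (t : nat) : finGroupType := ('Z_t * ('Z_2 * 'Z_2))%type.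

Definition gx {t} : G t := (1%R, (0%R, 0%R)).
Definition gu {t} : G t := (0%R, (1%R, 0%R)).
Definition gv {t} : G t := (0%R, (0%R, 1%R)).

(* Indices 1, ..., 4t as residues modulo 4t: the index 4t is represented by 0.
   For an index d = 4 j + e with 0 <= j < t and 1 <= e <= 4, the representative
   of d - 1 in 0, ..., 4t - 1 is 4 j + (e - 1), so idx_row d = j, idx_col d = e. *)
Definition Idx (t : nat) := 'Z_(4 * t).
Definition idx_row t (d : Idx t) : nat := (d - 1)%R %/ 4.
Definition idx_col t (d : Idx t) : nat := ((d - 1)%R %% 4).+1.

Definition elt t (d : Idx t) : G t :=
  gx ^+ idx_row d * nth 1 [:: 1; gu; gv; gu * gv] (idx_col d).-1.

(* Maps into {1, -1}, written as integers; [in_S_cocycle] shows that every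
   psi_D takes values in {1, -1} only. *)
Definition cochain (t : nat) := {ffun G t * G t -> int}.

Local Open Scope ring_scope.

Definition is_cocycle t (psi : cochain t) : Prop :=
  [/\ forall p, psi p = 1 \/ psi p = -1,
      forall g, psi (g, 1%g) = 1 /\ psi (1%g, g) = 1
    & forall g h k, psi (g, h) * psi ((g * h)%g, k)
                    = psi (g, (h * k)%g) * psi (h, k)].

Definition cobound t (f : G t -> int) : cochain t :=
  [ffun p => (f p.1)^-1 * (f p.2)^-1 * f (p.1 * p.2)%g].

Definition delta t (d : Idx t) (g : G t) : int :=
  if g == elt d then -1 else 1.

Definition partial t (d : Idx t) : cochain t :=
  if d == 1 then cobound (fun g => - delta d g) else cobound (delta d).

(* The position of u^a.1 v^a.2 in the list 1, u, v, uv. *)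
Definition V4_pos (a : 'Z_2 * 'Z_2) : nat := (a.1 + 2 * a.2)%N.

Definition rho0 (a b : 'Z_2 * 'Z_2) : int :=
  nth 0 (nth [::] [:: [:: 1;  1;  1;  1];
                      [:: 1; -1;  1; -1];
                      [:: 1; -1; -1;  1];
                      [:: 1;  1; -1; -1]] (V4_pos a)) (V4_pos b).

Definition rho t : cochain t := [ffun p => rho0 p.1.2 p.2.2].

Definition psi_of t (D : {set Idx t}) : cochain t :=
  [ffun p => (\prod_(d in D) partial d p) * rho t p].

Definition in_S t (psi : cochain t) : Prop := exists D, psi = psi_of D.

Definition in_class t (e : nat) (d : Idx t) : bool := d == e %[mod 4].

(* The set c_e of D; c_4 is selected by the residues that are 0 modulo 4. *)
Definition dclass t (e : nat) (D : {set Idx t}) : {set Idx t} :=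
  [set d in D | in_class e d].

Definition translate t (A : {set Idx t}) (k : Idx t) : {set Idx t} :=
  [set d + k | d in A].

Definition C2 t (D : {set Idx t}) : {set Idx t} :=
  ([set d | in_class 2 d] :\: dclass 2 D) :|: [set d in D | ~~ in_class 2 d].

Definition swap t (a b : nat) (D : {set Idx t}) : {set Idx t} :=
  translate (dclass b D) (- (b - a)%N%:R)
    :|: translate (dclass a D) (b - a)%N%:R
    :|: [set d in D | ~~ in_class a d && ~~ in_class b d].

Definition rotate t (i : nat) (D : {set Idx t}) : {set Idx t} :=
  \bigcup_(e <- [:: 2; 3; 4; 1]%N) translate (dclass e D) (- (4 * i)%N%:R).

Definition dil_idx t (r : {unit 'Z_t}) (d : Idx t) : Idx t :=
  (4 * ((idx_row d * (val r : 'Z_t)) %% t) + idx_col d)%N%:R.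

Definition dilate t (r : {unit 'Z_t}) (D : {set Idx t}) : {set Idx t} :=
  dil_idx r @: D.

(* The operation psi_D |-> psi_{F D}.  A cochain psi may be psi_D for several D;
   by [diag_actE] and the lemmas [respects_*] below, when t > 1 is odd the value
   is independent of that choice for F = C2, swap a b, rotate i or dilate r.
   Outside the set of all psi_D the value is irrelevant. *)
Definition diag_act t (F : {set Idx t} -> {set Idx t}) (psi : cochain t) :
    cochain t :=
  if [pick D | psi_of D == psi] is Some D then psi_of (F D) else psi.

Definition shift t (psi : cochain t) (a : G t) : cochain t :=
  [ffun p => psi ((a * p.1)%g, p.2) * (psi (a, p.2))^-1].

Definition aut_act t (theta : {perm G t}) (psi : cochain t) : cochain t :=
  [ffun p => psi (theta p.1, theta p.2)].

Definition h_fun t (r : {unit 'Z_t}) (g : G t) : G t :=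
  ((val r : 'Z_t) * g.1, g.2).
Definition h23_fun t (g : G t) : G t := (g.1, (g.2.2, g.2.1)).
Definition h243_fun t (g : G t) : G t := (g.1, (g.2.1 + g.2.2, g.2.1)).

Lemma h_inj t (r : {unit 'Z_t}) : injective (h_fun r).
Proof.
move=> [i a] [j b] e; congr (_, _); last exact: (congr1 snd e).
exact: (mulrI (valP r) (congr1 fst e)).
Qed.

Lemma h23_inj t : injective (@h23_fun t).
Proof. by move=> [i [a b]] [j [c d]] [-> -> ->]. Qed.

Lemma h243_inj t : injective (@h243_fun t).
Proof.
move=> [i [a b]] [j [c d]] e; move: (congr1 snd e) (congr1 fst e) => /= e2 ->.
move: (congr1 fst e2) (congr1 snd e2) => /= e3 e4.
by rewrite e4 in e3 *; rewrite (addrI _ e3).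
Qed.

Definition aut_h t (r : {unit 'Z_t}) : {perm G t} := perm (h_inj (r := r)).
Definition aut_h23 t : {perm G t} := perm (@h23_inj t).
Definition aut_h243 t : {perm G t} := perm (@h243_inj t).

Lemma gxX t n : (gx ^+ n)%g = (n%:R, (0, 0)) :> G t.
Proof.
by elim: n => // n IH; rewrite expgS IH [in RHS]mulrS; congr (_, (_, _)); apply: val_inj.
Qed.

Lemma aut_hP t (r : {unit 'Z_t}) :
  [/\ aut_h r \in Aut [set: G t], aut_h r gx = (gx ^+ (val r : 'Z_t))%g,
      aut_h r gu = gu & aut_h r gv = gv].
Proof.
split; last 3 first.
- by rewrite permE /h_fun gxX /= mulr1 natr_Zp.
- by rewrite permE /h_fun /= mulr0.
- by rewrite permE /h_fun /= mulr0.
rewrite inE; apply/andP; split; first by apply/subsetP=> g; rewrite !inE.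
apply/morphicP => g k _ _; rewrite !permE /h_fun.
by congr (_, _); rewrite /= [LHS]mulrDr.
Qed.

Lemma aut_h23P t :
  [/\ aut_h23 t \in Aut [set: G t], aut_h23 t gx = gx,
      aut_h23 t gu = gv & aut_h23 t gv = gu].
Proof.
split; try by rewrite permE.
rewrite inE; apply/andP; split; first by apply/subsetP=> g; rewrite !inE.
by apply/morphicP => g k _ _; rewrite !permE.
Qed.

Lemma aut_h243P t :
  [/\ aut_h243 t \in Aut [set: G t], aut_h243 t gx = gx,
      aut_h243 t gu = (gu * gv)%g & aut_h243 t gv = gu].
Proof.
split; try by rewrite permE; congr (_, (_, _)); apply: val_inj.
rewrite inE; apply/andP; split; first by apply/subsetP=> g; rewrite !inE.
apply/morphicP => g k _ _; rewrite !permE /h243_fun.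
by congr (_, (_, _)); rewrite /= [LHS]addrACA.
Qed.

Section Indices.
Variables (t : nat) (t_gt1 : (1 < t)%N).
Implicit Types (d : Idx t) (D : {set Idx t}) (g k : G t).

Lemma gt1_4t : (1 < 4 * t)%N.
Proof. by rewrite (leq_trans t_gt1) // leq_pmull. Qed.

Lemma val_Idx n : ((n%:R : Idx t) = (n %% (4 * t))%N :> nat).
Proof. exact: val_Zp_nat gt1_4t n. Qed.

Lemma ltn_Idx d : (d < 4 * t)%N.
Proof. by rewrite -{2}(Zp_cast gt1_4t). Qed.

Lemma Idx_mod4 n : ((n%:R : Idx t) %% 4 = n %% 4)%N.
Proof. by rewrite val_Idx modn_dvdm // dvdn_mulr. Qed.

Lemma ltn_row d : (idx_row d < t)%N.
Proof. by rewrite ltn_divLR // [(t * 4)%N]mulnC ltn_Idx. Qed.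

Lemma idxS d : (4 * idx_row d + idx_col d = (d - 1)%R.+1)%N.
Proof. by rewrite /idx_row /idx_col addnS [(4 * (_ %/ _))%N]mulnC -divn_eq. Qed.

Lemma idxK d : (4 * idx_row d + idx_col d)%N%:R = d.
Proof. by rewrite idxS -natr1 natr_Zp subrK. Qed.

Lemma idx_colE d : (idx_col d).-1 = nth 0%N [:: 3; 0; 1; 2] (d %% 4).
Proof.
rewrite -[in RHS](idxK d) Idx_mod4 [(4 * idx_row d)%N]mulnC modnMDl /idx_col /=.
have : ((d - 1)%R %% 4 < 4)%N by rewrite ltn_mod.
by case: (_ %% 4)%N => [|[|[|[|]]]].
Qed.

Definition V4_seq : seq ('Z_2 * 'Z_2) := [:: (1, 1); (0, 0); (1, 0); (0, 1)].

Lemma eltE d : elt d = ((idx_row d)%:R, nth (0, 0) V4_seq (d %% 4)).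
Proof.
rewrite /elt gxX idx_colE.
have : (d %% 4 < 4)%N by rewrite ltn_mod.
case: (d %% 4)%N => [|[|[|[|]]]] //= _; congr (_, _);
  try solve [exact: addr0 | congr (_, _); exact: val_inj].
by change ((idx_row d)%:R + (0 + 0) = (idx_row d)%:R :> 'Z_t); rewrite !addr0.
Qed.

Lemma idx_of j e : (j < t)%N -> (e < 4)%N ->
  idx_row ((4 * j + e.+1)%N%:R : Idx t) = j /\
  idx_col ((4 * j + e.+1)%N%:R : Idx t) = e.+1.
Proof.
move=> jt e4; rewrite /idx_row /idx_col.
have -> : ((4 * j + e.+1)%N%:R - 1 : Idx t) = (4 * j + e)%N%:R.
  by rewrite addnS -natr1 addrK.
have lt : (4 * j + e < 4 * t)%N.
  by apply: (@leq_trans (4 * j.+1)); rewrite ?leq_mul2l // mulnS addnC ltn_add2r.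
rewrite val_Idx (modn_small lt) [(4 * j)%N]mulnC divnMDl // modnMDl.
by rewrite divn_small // modn_small // addn0.
Qed.

Lemma idx_inj d d' : idx_row d = idx_row d' -> idx_col d = idx_col d' -> d = d'.
Proof. by move=> e1 e2; rewrite -(idxK d) -(idxK d') e1 e2. Qed.

Lemma elt_inj : injective (@elt t).
Proof.
move=> d d'; rewrite !eltE => [[]] e1 e2.
have e3 : idx_row d = idx_row d'.
  move: (congr1 (@nat_of_ord _) e1).
  by rewrite !val_Zp_nat // !modn_small // ltn_row.
apply: idx_inj => //.
rewrite -[idx_col d]prednK // -[idx_col d']prednK //; congr _.+1.
rewrite !idx_colE; congr nth.
have := ltn_mod d 4; have := ltn_mod d' 4; move: e2.
by case: (d %% 4)%N => [|[|[|[|]]]] //; case: (d' %% 4)%N => [|[|[|[|]]]].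
Qed.

Lemma card_G : #|G t| = (4 * t)%N.
Proof. by rewrite !card_prod !card_ord Zp_cast // mulnC. Qed.

Lemma elt_bij : bijective (@elt t).
Proof.
apply: inj_card_bij; first exact: elt_inj.
by rewrite card_G card_ord Zp_cast ?gt1_4t.
Qed.

Definition sgn d g : int := if d == 1 then - delta d g else delta d g.
Definition Sgn D g : int := \prod_(d in D) sgn d g.

Lemma sgn_sq d g : sgn d g * sgn d g = 1.
Proof. by rewrite /sgn /delta; do 2!case: ifP. Qed.

Lemma Sgn_sq D g : Sgn D g * Sgn D g = 1.
Proof. by rewrite -big_split big1 // => d _; rewrite /= sgn_sq. Qed.

Lemma rho0_sq a b : rho0 a b * rho0 a b = 1.
Proof.
move: a b => [[[|[|?]] ?] [[|[|?]] ?]] [[[|[|?]] ?] [[|[|?]] ?]] //.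
Qed.

Lemma psi_ofE D g k :
  psi_of D (g, k) = Sgn D g * Sgn D k * Sgn D (g * k)%g * rho0 g.2 k.2.
Proof.
rewrite /psi_of !ffunE /=; congr (_ * _); rewrite -!big_split /=.
by apply: eq_bigr => d _; rewrite /partial /sgn; case: ifP => _; rewrite ffunE.
Qed.

Lemma sign_elt D d :
  Sgn D (elt d) = (-1) ^+ ((1 : Idx t) \in D) * (-1) ^+ (d \in D).
Proof.
have dE c : sgn c (elt d) =
    (if c == 1 then -1 else 1) * (if c == d then -1 else 1).
  rewrite /sgn /delta (inj_eq elt_inj) [d == c]eq_sym.
  by do 2!case: ifP.
rewrite /Sgn (eq_bigr _ (fun c _ => dE c)) big_split /=.
have E e : \prod_(c in D) (if c == e then -1 else 1) = (-1) ^+ (e \in D) :> int.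
  case: (boolP (e \in D)) => eD.
    by rewrite (bigD1 e) //= eqxx big1 ?mulr1 // => c /andP[_ /negPf->].
  rewrite big1 // => c cD; case: eqP => // ce; by rewrite -ce cD in eD.
by rewrite !E.
Qed.

Definition equiv_sets D1 D2 := exists f : nat -> bool,
  f 0%N (+) f 1%N (+) f 2%N (+) f 3%N = false
  /\ forall d, (d \in D1) = (d \in D2) (+) f (d %% 4)%N.

Lemma psi_of_sign D1 D2 g k : psi_of D1 = psi_of D2 ->
  Sgn D1 (g * k)%g * Sgn D2 (g * k)%g
  = (Sgn D1 g * Sgn D2 g) * (Sgn D1 k * Sgn D2 k).
Proof.
move=> /ffunP/(_ (g, k)); rewrite !psi_ofE => /(congr1 ( *%R^~ (rho0 g.2 k.2))).
rewrite -!mulrA rho0_sq !mulr1.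
move: (Sgn_sq D1 g) (Sgn_sq D1 k) (Sgn_sq D1 (g * k)%g).
move: (Sgn_sq D2 g) (Sgn_sq D2 k) (Sgn_sq D2 (g * k)%g).
move: (Sgn D1 g) (Sgn D1 k) (Sgn D1 (g * k)%g).
move: (Sgn D2 g) (Sgn D2 k) (Sgn D2 (g * k)%g).
move=> a' b' c' a b c e1 e2 e3 e4 e5 e6 e.
transitivity ((a * a) * (b * b) * (c * c')); first by rewrite e4 e5 !mul1r.
transitivity (a * b * (a * (b * c)) * c'); first by ring.
rewrite e; transitivity (a * a' * (b * b') * (c' * c')); first by ring.
by rewrite e3 mulr1 -mulrA.
Qed.

Lemma sqr1_odd (a : int) : a * a = 1 -> a ^+ t = 1 -> odd t -> a = 1.
Proof.
move=> a2 at1 ot; move: at1; rewrite -(odd_double_half t) ot -mul2n.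
by rewrite exprD exprM expr2 a2 expr1n mulr1 expr1.
Qed.

Hypothesis t_odd : odd t.

Lemma psi_of_inj D1 D2 : psi_of D1 = psi_of D2 -> equiv_sets D1 D2.
Proof.
move=> e; pose X g := Sgn D1 g * Sgn D2 g.
have XM g k : X (g * k)%g = X g * X k by apply: psi_of_sign.
have X2 g : X g * X g = 1.
  by rewrite /X mulrACA !Sgn_sq.
have X1 : X 1%g = 1 by have := X2 1%g; rewrite -XM mulg1.
have XX g n : X (g ^+ n)%g = X g ^+ n.
  by elim: n => [|n IH]; rewrite ?expg0 ?expr0 // expgS XM IH exprS.
have Xx : X gx = 1.
  apply: sqr1_odd => //; rewrite -XX gxX pchar_Zp //.
have Xa g : X g = X (0, g.2).
  have gE : g = (gx ^+ (g.1 : 'Z_t) * (0, g.2))%g.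
    case: g => i [a b]; rewrite gxX natr_Zp.
    congr (_, (_, _)); by rewrite /= ?[RHS]addr0 // [RHS]add0r.
  by rewrite [in LHS]gE XM XX Xx expr1n mul1r.
pose s : bool := ((1 : Idx t) \in D1) (+) ((1 : Idx t) \in D2).
have Xe d : X (elt d) = (-1) ^+ (s (+) ((d \in D1) (+) (d \in D2))).
  rewrite /X !sign_elt /s !signr_addb; ring.
pose f n := ((n%:R : Idx t) \in D1) (+) ((n%:R : Idx t) \in D2).
have Xf d : X (elt d) = (-1) ^+ (s (+) f (d %% 4)%N).
  by rewrite -Xe Xa [in RHS]Xa !eltE Idx_mod4 modn_mod.
exists f; split; last first.
  move=> d; move: (Xf d); rewrite Xe => /(@signr_inj int) /addbI <-.
  by rewrite addbC addbK.
clearbody f s.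
have Xn n : (n < 4)%N -> (-1) ^+ (s (+) f n) = X (0, nth (0, 0) V4_seq n).
  move=> n4; rewrite -{1}(modn_small n4) -Idx_mod4 -Xf Xa eltE Idx_mod4.
  by rewrite modn_small.
apply: (@signr_inj int).
transitivity (X (0, nth (0, 0) V4_seq 0) * X (0, nth (0, 0) V4_seq 1)
              * X (0, nth (0, 0) V4_seq 2) * X (0, nth (0, 0) V4_seq 3)).
  rewrite -!Xn // !signr_addb.
  by case: (s); case: (f 0%N); case: (f 1%N); case: (f 2%N); case: (f 3%N).
by rewrite /= expr0 -!XM -X1; congr (X (_, (_, _))); apply: val_inj.
Qed.

Lemma psi_of_equiv D1 D2 : equiv_sets D1 D2 -> psi_of D1 = psi_of D2.
Proof.
move=> [f [f4 fP]].
have inv : exists e, cancel e (@elt t).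
  by have [e _ eK] := elt_bij; exists e.
case: inv => inv invK.
pose Y (a : 'Z_2 * 'Z_2) : int :=
  (-1) ^+ (f 1%N (+) f (nth 0%N [:: 1; 2; 3; 0] (V4_pos a))).
have SY g : Sgn D1 g = Sgn D2 g * Y g.2.
  rewrite -(invK g) !sign_elt !fP /Y eltE /= !signr_addb.
  have -> : nth 0%N [:: 1; 2; 3; 0]%N
    (V4_pos (nth (0, 0) V4_seq (inv g %% 4)%N)) = (inv g %% 4)%N.
    have : (inv g %% 4 < 4)%N by rewrite ltn_mod.
    by case: (_ %% 4)%N => [|[|[|[|]]]].
  rewrite (Idx_mod4 1); ring.
have YM a b : Y a * Y b * Y (a * b)%g = 1.
  move: f4; rewrite /Y; clear.
  move: a b => [[[|[|?]] ?] [[|[|?]] ?]] [[[|[|?]] ?] [[|[|?]] ?]] //=;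
  by case: (f 0%N); case: (f 1%N); case: (f 2%N); case: (f 3%N).
apply/ffunP => [[g k]]; rewrite !psi_ofE !SY; congr (_ * _).
rewrite -[RHS]mulr1 -(YM g.2 k.2); ring.
Qed.
Lemma in_S_cocycle (psi : cochain t) : in_S psi -> is_cocycle psi.
Proof.
case=> D ->.
have S1 : Sgn D 1%g = 1.
  have -> : 1%g = elt (1 : Idx t).
    by rewrite eltE (Idx_mod4 1) /idx_row subrr.
  by rewrite sign_elt -signr_addb addbb.
have pm (a : int) : a * a = 1 -> a = 1 \/ a = -1.
  by rewrite -expr2 => /eqP; rewrite sqrf_eq1 => /orP[]/eqP; [left|right].
have rho01 a : rho0 a 1%g = 1 /\ rho0 1%g a = 1.
  by move: a => [[[|[|?]] ?] [[|[|?]] ?]].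
have rho0P a b c : rho0 a b * rho0 (a * b)%g c = rho0 a (b * c)%g * rho0 b c.
  by move: a b c => [[[|[|?]] ?] [[|[|?]] ?]] [[[|[|?]] ?] [[|[|?]] ?]]
                    [[[|[|?]] ?] [[|[|?]] ?]].
split.
- move=> [g k]; apply: pm; rewrite psi_ofE.
  move: (Sgn_sq D g) (Sgn_sq D k) (Sgn_sq D (g * k)%g) (rho0_sq g.2 k.2).
  move: (Sgn D g) (Sgn D k) (Sgn D (g * k)%g) (rho0 _ _) => a b c d e1 e2 e3 e4.
  transitivity ((a * a) * (b * b) * (c * c) * (d * d)); first by ring.
  by rewrite e1 e2 e3 e4.
- move=> g; rewrite !psi_ofE mulg1 mul1g S1 (rho01 g.2).1 (rho01 g.2).2.
  by rewrite !mulr1 mul1r Sgn_sq.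
- move=> g k l; rewrite !psi_ofE mulgA.
  have : rho0 g.2 k.2 * rho0 (g * k)%g.2 l.2
         = rho0 g.2 (k * l)%g.2 * rho0 k.2 l.2 by exact: rho0P.
  move: (Sgn_sq D (g * k)%g) (Sgn_sq D (k * l)%g).
  move: (rho0 g.2 k.2) (rho0 (g * k)%g.2 l.2) (rho0 g.2 (k * l)%g.2)
        (rho0 k.2 l.2) (Sgn D (g * k * l)%g) (Sgn D (g * k)%g)
        (Sgn D (k * l)%g) (Sgn D g) (Sgn D k) (Sgn D l).
  move=> r1 r2 r3 r4 abc ab bc a b c e2 e3 e1.
  transitivity (a * b * c * abc * (ab * ab) * (r1 * r2)); first by ring.
  by rewrite e1 e2 -e3; ring.
Qed.

Lemma Idx_add d n : ((d + n%:R)%R %% 4 = (d + n) %% 4)%N.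
Proof. by rewrite -{1}(natr_Zp d) -natrD Idx_mod4. Qed.

Lemma in_classD d a b : (a <= b)%N -> in_class b (d + (b - a)%N%:R) = in_class a d.
Proof.
by move=> ab; rewrite /in_class Idx_add -(eqn_modDr a) -addnA subnK // addnC eqn_modDl.
Qed.

Lemma mem_translate A (k d : Idx t) : (d \in translate A k) = (d - k \in A).
Proof.
apply/imsetP/idP => [[c cA ->]|dA]; first by rewrite addrK.
by exists (d - k); rewrite ?subrK.
Qed.

Lemma mem_swap a b D d : (1 <= a < b)%N -> (b <= 4)%N ->
  (d \in swap a b D) =
    if in_class a d then d + (b - a)%N%:R \in D
    else if in_class b d then d - (b - a)%N%:R \in D else d \in D.
Proof.
move=> /andP[a1 ab] b4; rewrite !inE !mem_translate !inE opprK.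
rewrite (in_classD _ (ltnW ab)) -[in_class a (d - _)](in_classD _ (ltnW ab)) subrK.
case da: (in_class a d); case db: (in_class b d); rewrite ?andbF ?orbF ?andbT //.
have : a == b %[mod 4] by rewrite -(eqP da) -(eqP db).
by move: a b a1 ab b4 {da db} => [|[|[|[|[|?]]]]] [|[|[|[|[|?]]]]].
Qed.

Lemma mem_rotate i D d : (d \in rotate i D) = (d + (4 * i)%N%:R \in D).
Proof.
rewrite /rotate !big_cons big_nil !inE !mem_translate !inE opprK /in_class.
rewrite orbF -!andb_orr.
have : ((d + (4 * i)%:R)%R %% 4 < 4)%N by rewrite ltn_mod.
by case: (_ %% 4)%N => [|[|[|[|]]]]; rewrite ?andbT.
Qed.

Lemma mem_C2 D d : (d \in C2 D) = in_class 2 d (+) (d \in D).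
Proof. by rewrite !inE; case: (in_class 2 d); case: (d \in D). Qed.

Lemma dil_idx_mod4 r d : (dil_idx r d %% 4 = d %% 4)%N.
Proof.
by rewrite -{2}(idxK d) /dil_idx !Idx_mod4 ![(4 * _)%N]mulnC !modnMDl.
Qed.

Lemma dil_idxP r d :
  idx_row (dil_idx r d) = (idx_row d * (val r : 'Z_t) %% t)%N
  /\ idx_col (dil_idx r d) = idx_col d.
Proof.
by apply: idx_of; rewrite ?ltn_mod 1?ltnW.
Qed.

Lemma dil_idx_inj r : injective (@dil_idx t r).
Proof.
move=> c d e; have [c1 c2] := dil_idxP r c; have [d1 d2] := dil_idxP r d.
apply: idx_inj; last by rewrite -c2 -d2 e.
have : ((idx_row c)%:R * (val r : 'Z_t) = (idx_row d)%:R * val r).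
  rewrite -[val r]natr_Zp -!natrM -[LHS](Zp_nat_mod t_gt1) -[RHS](Zp_nat_mod t_gt1).
  by rewrite -c1 -d1 e.
move=> /(mulIr (valP r)) /(congr1 (@nat_of_ord _)).
by rewrite !val_Zp_nat // !modn_small // ltn_row.
Qed.

Definition respects (F : {set Idx t} -> {set Idx t}) : Prop :=
  forall D1 D2, equiv_sets D1 D2 -> equiv_sets (F D1) (F D2).

Lemma respects_rotate i : respects (rotate i).
Proof.
move=> D1 D2 [f [f4 fP]]; exists f; split=> // d.
by rewrite !mem_rotate fP Idx_add addnC -modnDml modnMr add0n.
Qed.

Lemma respects_C2 : respects (@C2 t).
Proof.
by move=> D1 D2 [f [f4 fP]]; exists f; split=> // d; rewrite !mem_C2 fP addbA.
Qed.

Lemma respects_dilate r : respects (dilate r).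
Proof.
move=> D1 D2 [f [f4 fP]]; exists f; split=> // d.
have [e _ eK] := injF_bij (@dil_idx_inj r).
by rewrite -(eK d) !(mem_imset _ _ (@dil_idx_inj r)) fP dil_idx_mod4.
Qed.

Lemma respects_swap a b : (1 <= a < b)%N -> (b <= 4)%N -> respects (swap a b).
Proof.
move=> ab b4 D1 D2 [f [f4 fP]].
exists (fun n => if n == a %% 4 then f (b %% 4)%N
                 else if n == b %% 4 then f (a %% 4)%N else f n)%N; split.
  move: ab b4 f4; case: a b => [|[|[|[|?]]]] [|[|[|[|[|?]]]]] //= _ _;
  by case: (f 0%N); case: (f 1%N); case: (f 2%N); case: (f 3%N).
move=> d; rewrite !mem_swap // !fP {f4 fP} -/(in_class a d) -/(in_class b d).
have ltab : (a <= b)%N by case/andP: ab => _ /ltnW.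
case: ifP => [da|_].
  have /eqP-> : in_class b (d + (b - a)%N%:R) by rewrite in_classD.
  by [].
case: ifP => // db.
have /eqP-> // : in_class a (d - (b - a)%N%:R).
by rewrite -(in_classD _ ltab) subrK.
Qed.

Lemma diag_actE F D : respects F -> diag_act F (psi_of D) = psi_of (F D).
Proof.
move=> FP; rewrite /diag_act; case: pickP => [D' /eqP e|/(_ D)]; last by rewrite eqxx.
by apply/psi_of_equiv/FP/psi_of_inj.
Qed.

End Indices.

(* Main.v *)
Require Import Defs.
From mathcomp Require Import all_boot all_order all_fingroup all_algebra.
From mathcomp Require Import ring.

(** A cocycle [psi_of D] is determined by the sign function [Sgn D] on [G t]:
    by [psi_ofE],
      psi_D(g, k) = Sgn_D(g) Sgn_D(k) Sgn_D(gk) rho(g, k),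
    where Sgn_D(g) is -1 exactly on the elements listed by D, up to the global
    sign that makes Sgn_D(1) = 1.  Both kinds of action can therefore be read
    on sign functions.

    - The matrix [rho0] is multiplicative in its first argument ([rho0Ml]).  So
      in the shift psi(ag, k) psi(a, k)^-1 the factor rho(ag, k) / rho(a, k) is
      rho(g, k) again, the two copies of Sgn(k) cancel, and the result is the
      cocycle with sign function g |-> Sgn(ag) Sgn(a) ([shift_psi_of]).
    - An automorphism theta turns Sgn into Sgn o theta and rho into
      rho o (theta x theta); when the latter is rho times the coboundary of q,
      the new sign function is (Sgn o theta) q ([aut_act_psi_of]).  Only the
      exchange of u and v needs a nontrivial q, namely -1 on the coset of v.
      The complementation [C2] supplies it: it changes the sign on the coset of
      u, which the swapping of classes 2 and 3 then moves to that of v.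

    On the other side, rotations, swappings and dilatations permute indices, so
    that they precompose the sign function with a permutation of G and
    renormalize it at 1 ([Sgn_pullback]); a swapping permutes only the second
    coordinate, by a transposition ([Sgn_swap]).  The theorem then compares
    permutations of Z_2 x Z_2: multiplication by u is (1 u)(v uv),
    multiplication by v is (1 v)(u uv), and the two automorphisms are (u v) and
    the 3-cycle u |-> uv |-> v |-> u. *)

Set Implicit Arguments.
Unset Strict Implicit.
Unset Printing Implicit Defensive.

Import GroupScope GRing.Theory Num.Theory.
Local Open Scope ring_scope.

Lemma rho0Ml a b c : rho0 (a * b)%g c = rho0 a c * rho0 b c.
Proof.
by move: a b c => [[[|[|?]] ?] [[|[|?]] ?]] [[[|[|?]] ?] [[|[|?]] ?]]
                  [[[|[|?]] ?] [[|[|?]] ?]].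
Qed.

Section SignFunctions.
Variables (t : nat) (t_gt1 : (1 < t)%N).
Implicit Types (d : Idx t) (D : {set Idx t}) (g k : G t).

Lemma elt1 : elt (1 : Idx t) = 1%g.
Proof. by rewrite (eltE t_gt1) (Idx_mod4 t_gt1 1) /idx_row subrr. Qed.

Lemma Sgn1 D : Sgn D 1%g = 1.
Proof. by rewrite -elt1 (sign_elt t_gt1) -signr_addb addbb. Qed.

Lemma elt_surj g : exists d, elt d = g.
Proof. by have [f _ fK] := elt_bij t_gt1; exists (f g). Qed.

(** The factor [Sgn D (theta 1)] restores the value 1 at the identity, which
    [theta] may move. *)
Lemma Sgn_pullback (theta : G t -> G t) D D' :
    (forall d, exists2 d', elt d' = theta (elt d) & (d \in D') = (d' \in D)) ->
  forall g, Sgn D' g = Sgn D (theta g) * Sgn D (theta 1%g).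
Proof.
move=> thetaP g; have [d <-] := elt_surj g.
have [d' <- dD] := thetaP d; have [c' Ec cD] := thetaP 1.
rewrite -elt1 -Ec !(sign_elt t_gt1) dD cD -!signr_addb; congr (_ ^+ nat_of_bool _).
by do 3!case: (_ \in _).
Qed.

(** Reduction modulo 4 lets the class numbers 1, ..., 4 and the residues of
    indices name the same elements: 4 and 0 both give uv. *)
Definition V4_elt (e : nat) : 'Z_2 * 'Z_2 := nth (0, 0) V4_seq (e %% 4).

Definition swap_G (a b : nat) (g : G t) : G t :=
  (g.1, tperm (V4_elt a) (V4_elt b) g.2).

Lemma elt_of j e : (j < t)%N -> (1 <= e <= 4)%N ->
  elt ((4 * j + e)%N%:R : Idx t) = (j%:R, V4_elt e).
Proof.
case: e => // e jt /andP[_ e4]; have [r _] := idx_of t_gt1 jt e4.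
by rewrite (eltE t_gt1) r (Idx_mod4 t_gt1) [(4 * j)%N]mulnC modnMDl.
Qed.

Lemma V4_elt_inj a b : (1 <= a <= 4)%N -> (1 <= b <= 4)%N ->
  V4_elt a = V4_elt b -> a = b.
Proof. by move: a b => [|[|[|[|[|?]]]]] [|[|[|[|[|?]]]]]. Qed.

Lemma Sgn_swap a b D g : (1 <= a < b)%N -> (b <= 4)%N ->
  Sgn (swap a b D) g = Sgn D (swap_G a b g) * Sgn D (swap_G a b 1%g).
Proof.
move=> ab b4; apply: Sgn_pullback => {g} d.
have [a1 ltab] := andP ab; have leab := ltnW ltab.
have a14 : (1 <= a <= 4)%N by rewrite a1 (leq_trans leab).
have b14 : (1 <= b <= 4)%N by rewrite (leq_trans a1 leab).
rewrite (mem_swap t_gt1) //.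
have jt := ltn_row t_gt1 d; have e14 : (1 <= idx_col d <= 4)%N.
  by rewrite /idx_col /= ltn_mod.
move: (idx_row d) (idx_col d) (idxK d) jt e14 => j e <- jt e14.
have cls c : (1 <= c <= 4)%N -> in_class c ((4 * j + e)%N%:R : Idx t) = (e == c).
  rewrite /in_class (Idx_mod4 t_gt1) [(4 * j)%N]mulnC modnMDl => {jt}.
  by move: c e e14 => [|[|[|[|[|?]]]]] [|[|[|[|[|?]]]]].
rewrite !cls // /swap_G elt_of //=.
case: eqP => [->|/eqP ea].
  exists ((4 * j + b)%N%:R); first by rewrite elt_of // tpermL.
  by rewrite -natrD -addnA subnKC.
case: eqP => [->|/eqP eb].
  exists ((4 * j + a)%N%:R); first by rewrite elt_of // tpermR.
  have -> : (4 * j + b = 4 * j + a + (b - a))%N by rewrite -addnA subnKC.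
  by rewrite natrD addrK.
exists ((4 * j + e)%N%:R) => //; rewrite elt_of // tpermD //.
  by apply: contraNneq ea => /V4_elt_inj->.
by apply: contraNneq eb => /V4_elt_inj->.
Qed.

Lemma Sgn_rotate1 D g : Sgn (rotate 1 D) g = Sgn D (gx * g)%g * Sgn D gx.
Proof.
rewrite (@Sgn_pullback (fun g => gx * g)%g D) ?mulg1 // => {g} d.
exists (d + (4 * 1)%N%:R); last by rewrite mem_rotate.
have jt := ltn_row t_gt1 d; have e14 : (1 <= idx_col d <= 4)%N.
  by rewrite /idx_col /= ltn_mod.
move: (idx_row d) (idx_col d) (idxK d) jt e14 => j e <- jt e14.
rewrite elt_of // -natrD addnAC -mulnDr addn1.
have -> : ((4 * j.+1 + e)%N%:R : Idx t) = (4 * (j.+1 %% t) + e)%N%:R.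
  (* a last row is followed by row 0, since 4t = 0 as an index *)
  move: jt; rewrite leq_eqVlt => /orP[/eqP->|jt]; last by rewrite modn_small.
  by rewrite modnn muln0 natrD add0n pchar_Zp ?gt1_4t ?add0r.
rewrite elt_of ?ltn_mod ?(ltnW t_gt1) // Zp_nat_mod // -natr1 addrC.
by congr (_, _); rewrite -[LHS]mul1g.
Qed.

(** The inverse appears because D enters through its image under a dilatation,
    and the image under V_{1/r} is the preimage under V_r. *)
Lemma Sgn_dilateV (r : {unit 'Z_t}) D g :
  Sgn (dilate (r^-1)%g D) g = Sgn D (aut_h r g).
Proof.
have h1 : aut_h r 1%g = 1%g by rewrite permE /h_fun /= mulr0.
rewrite (@Sgn_pullback (aut_h r) D) ?h1 ?Sgn1 ?mulr1 // => {g} d.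
have elt_dil (s : {unit 'Z_t}) c : elt (dil_idx s c) = aut_h s (elt c).
  have [rowE _] := dil_idxP t_gt1 s c.
  rewrite permE /h_fun !(eltE t_gt1) (dil_idx_mod4 t_gt1) rowE /=.
  by congr (_, _); rewrite Zp_nat_mod // natrM natr_Zp mulrC.
exists (dil_idx r d) => //.
have dilK : dil_idx (r^-1)%g (dil_idx r d) = d.
  apply: (elt_inj t_gt1); rewrite !elt_dil !permE /h_fun.
  case: (elt d) => i a; congr (_, _).
  by rewrite /= mulKr //; exact: (valP r).
by rewrite -{1}dilK (mem_imset _ _ (dil_idx_inj t_gt1 (r := _))).
Qed.

(** The normalization at 1 is unaffected, as index 1 is not in class 2. *)
Lemma Sgn_C2 D g : Sgn (C2 D) g = Sgn D g * (-1) ^+ (g.2 == V4_elt 2).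
Proof.
have [d <-] := elt_surj g.
have not2 : in_class 2 (1 : Idx t) = false by rewrite /in_class (Idx_mod4 t_gt1 1).
rewrite !(sign_elt t_gt1) !mem_C2 not2 addFb -!signr_addb -addbA.
rewrite [_ (+) (d \in D)]addbC (eltE t_gt1) /in_class.
congr (_ ^+ nat_of_bool (_ (+) (_ (+) _))).
have : (d %% 4 < 4)%N by rewrite ltn_mod.
by case: (d %% 4)%N => [|[|[|[|]]]].
Qed.

Lemma shift_psi_of a D D' :
    (forall g, Sgn D' g = Sgn D (a * g)%g * Sgn D a) ->
  shift (psi_of D) a = psi_of D'.
Proof.
move=> SE; apply/ffunP=> [[g k]]; rewrite ffunE /=.
have inv p : (psi_of D p)^-1 = psi_of D p.
  have [/(_ p) pm _ _] := in_S_cocycle t_gt1 (ex_intro _ D erefl).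
  by case: pm => ->; rewrite ?invr1 ?invrN1.
rewrite inv !(psi_ofE, SE) mulgA.
rewrite [rho0 (a * g)%g.2 k.2](rho0Ml a.2 g.2).
move: (Sgn_sq D k) (Sgn_sq D a) (rho0_sq a.2 k.2).
move: (Sgn D k) (Sgn D a) (rho0 a.2 k.2) => x y z x2 y2 z2.
rewrite [LHS](_ : _ = Sgn D (a * g)%g * Sgn D (a * g * k)%g * y *
  Sgn D (a * k)%g * rho0 g.2 k.2 * ((x * x) * (z * z))); last by ring.
rewrite [RHS](_ : _ = Sgn D (a * g)%g * Sgn D (a * g * k)%g * y *
  Sgn D (a * k)%g * rho0 g.2 k.2 * (y * y)); last by ring.
by rewrite x2 y2 z2.
Qed.

Lemma aut_act_psi_of (theta : {perm G t}) (q : G t -> int) D D' :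
    theta \in Aut [set: G t] ->
    (forall g k, rho0 (theta g).2 (theta k).2
                 = q g * q k * q (g * k)%g * rho0 g.2 k.2) ->
    (forall g, Sgn D' g = Sgn D (theta g) * q g) ->
  aut_act theta (psi_of D) = psi_of D'.
Proof.
move=> /Aut_morphic/morphicP thetaM rhoE SE.
apply/ffunP=> [[g k]]; rewrite ffunE /= !(psi_ofE, SE) rhoE.
by rewrite -thetaM ?inE //; ring.
Qed.

Lemma gu_swap g : (gu * g)%g = swap_G 1 2 (swap_G 3 4 g).
Proof.
case: g => i a; rewrite /swap_G /=.
congr (_, _); first by rewrite -[RHS]add0r.
apply/eqP; rewrite !permE.
by move: a => [[[|[|?]] ?] [[|[|?]] ?]].
Qed.

Lemma gv_swap g : (gv * g)%g = swap_G 1 3 (swap_G 2 4 g).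
Proof.
case: g => i a; rewrite /swap_G /=.
congr (_, _); first by rewrite -[RHS]add0r.
apply/eqP; rewrite !permE.
by move: a => [[[|[|?]] ?] [[|[|?]] ?]].
Qed.

Lemma aut_h23_swap g : aut_h23 t g = swap_G 2 3 g.
Proof.
case: g => i a; rewrite permE /h23_fun /swap_G; congr (_, _).
apply/eqP; rewrite !permE.
by move: a => [[[|[|?]] ?] [[|[|?]] ?]].
Qed.

Lemma aut_h243_swap g : aut_h243 t g = swap_G 2 3 (swap_G 2 4 g).
Proof.
case: g => i a; rewrite permE /h243_fun /swap_G; congr (_, _).
apply/eqP; rewrite !permE.
by move: a => [[[|[|?]] ?] [[|[|?]] ?]].
Qed.

(** The renormalizing factor of the first swapping occurs twice and cancels. *)
Lemma Sgn_swap2 a b c e D g : (1 <= a < b)%N -> (b <= 4)%N ->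
    (1 <= c < e)%N -> (e <= 4)%N ->
  Sgn (swap c e (swap a b D)) g
    = Sgn D (swap_G a b (swap_G c e g)) * Sgn D (swap_G a b (swap_G c e 1%g)).
Proof.
move=> ab b4 ce e4; rewrite !(Sgn_swap, Sgn_swap D) //.
by rewrite mulrACA Sgn_sq // mulr1.
Qed.

End SignFunctions.

Theorem theorem3 (t : nat) (t_gt1 : (1 < t)%N) (t_odd : odd t)
    (psi : cochain t) (psi_S : in_S psi) :
  (shift psi gx = diag_act (rotate 1) psi
   /\ shift psi gu = diag_act (swap 3 4) (diag_act (swap 1 2) psi)
   /\ shift psi gv = diag_act (swap 2 4) (diag_act (swap 1 3) psi))
  /\
  ((forall r : {unit 'Z_t},
      aut_act (aut_h r) psi = diag_act (dilate (r^-1)%g) psi)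
   /\ aut_act (aut_h23 t) psi = diag_act (swap 2 3) (diag_act (@C2 t) psi)
   /\ aut_act (aut_h243 t) psi = diag_act (swap 2 4) (diag_act (swap 2 3) psi)).
Proof.
case: psi_S => D ->.
have actE F (E : {set Idx t}) (FP : respects F) := diag_actE t_gt1 t_odd E FP.
have swapE a b (E : {set Idx t}) (ab : (1 <= a < b)%N) (b4 : (b <= 4)%N) :
    diag_act (swap a b) (psi_of E) = psi_of (swap a b E).
  by apply: actE; apply: respects_swap.
rewrite (actE (rotate 1)); last exact: respects_rotate.
rewrite (actE (@C2 t)); last exact: respects_C2.
rewrite !swapE //; split; split.
- by apply: shift_psi_of => // g; apply: Sgn_rotate1.
- split; apply: shift_psi_of => // g; rewrite Sgn_swap2 //.
    by rewrite -!gu_swap mulg1.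
  by rewrite -!gv_swap mulg1.
- move=> r; rewrite (actE (dilate (r^-1)%g)); last exact: respects_dilate.
  have [hA _ _ _] := aut_hP r.
  apply: (aut_act_psi_of (q := fun=> 1)) => // [g k|g].
    by rewrite !permE /= !mul1r.
  by rewrite mulr1 Sgn_dilateV.
split.
- have [hA _ _ _] := aut_h23P t.
  apply: (aut_act_psi_of (q := fun g => (-1) ^+ (g.2 == V4_elt 3))) => // [g k|g].
    rewrite !permE /h23_fun; case: g k => [i a] [j b] /=.
    by move: a b => [[[|[|?]] ?] [[|[|?]] ?]] [[[|[|?]] ?] [[|[|?]] ?]].
  rewrite Sgn_swap // -!aut_h23_swap !Sgn_C2 //.
  have -> : aut_h23 t 1%g = 1%g by rewrite permE.
  rewrite Sgn1 // !mulr1; congr (_ * _ ^+ nat_of_bool _); rewrite permE.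
  by case: g => i [[[|[|?]] ?] [[|[|?]] ?]].
- have [hA _ _ _] := aut_h243P t.
  apply: (aut_act_psi_of (q := fun=> 1)) => // [g k|g].
    rewrite !permE /h243_fun; case: g k => [i a] [j b] /=.
    by move: a b => [[[|[|?]] ?] [[|[|?]] ?]] [[[|[|?]] ?] [[|[|?]] ?]].
  rewrite Sgn_swap2 // -!aut_h243_swap !mulr1.
  have -> : aut_h243 t 1%g = 1%g by rewrite permE; apply/eqP.
  by rewrite Sgn1 // mulr1.
Qed.
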